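(* Let $d\ge 4$ be an even integer and suppose that $d=r+s$ with $r=s$. Suppose that $\alpha\neq\beta$ in $\mathbb{T}$ satisfy Condition (P) (with respect to $r,s$). Let $V:=\alpha I_r\oplus\beta I_r\in\mathcal{U}(\mathbb{C}^d)$. Then $V\in\mathrm{Sym}_3(\mathbb{C}^d)$ if and only if one of the following four conditions holds: (a) $d$ is divisible by $4$, $(\alpha\beta)^r=-1$, and $|(\alpha\beta)^{2j-1}-1|<|\alpha-\beta|$ for all $1\le j\le r$; (b) $d$ is not divisible by $4$, and $|(\alpha\beta)^{2j-1}-1|<|\alpha-\beta|$ for all $1\le j\le r$; (c) $d$ is not divisible by $4$, $(\alpha\beta)^r=-1$, and $|e^{i\frac{r-1}{r}\pi}-1|<|\alpha-\beta|$; (d) $d$ is not divisible by $4$, $(\alpha\beta)^r=-1$, and $|1-\alpha^{2j+1}\beta^{2j-1}|<|\alpha-\beta|$ for all $1\le j\le r-1$.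
   Context: $\mathbb{T}=\{z\in\mathbb{C}:|z|=1\}$; $\mathcal{U}(\mathbb{C}^d)$ is the group of unitary $d\times d$ matrices. A symmetry on $\mathbb{C}^d$ is an operator $J$ with $J=J^*=J^{-1}$. $\mathrm{Sym}_k(\mathbb{C}^d)$ is the set of all products $J_1J_2\cdots J_k$ of $k$ symmetries on $\mathbb{C}^d$. Condition (P): for $d=r+s$ with integers $1\le s\le r$, the numbers $\alpha\ne\beta\in\mathbb{T}$ satisfy Condition (P) if (i) $\alpha^r\beta^s\in\{-1,1\}$, and (ii) whenever $i,j\ge 0$ are integers, not both zero, with $\alpha^i\beta^j\in\{-1,1\}$, then $i+j\ge d$. (In particular $\alpha,\beta\notin\{-1,1\}$.) *)

(* Defs.v *)
From HB Require Import structures.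
From mathcomp Require Import all_boot all_order all_algebra.
From mathcomp Require Import complex.
From mathcomp Require Import reals trigo.

Set Implicit Arguments.
Unset Strict Implicit.
Unset Printing Implicit Defensive.

Import Order.TTheory GRing.Theory Num.Theory.
Local Open Scope ring_scope.
Local Open Scope complex_scope.
Local Open Scope sesquilinear_scope.

(* invmx J = J alone does not give invertibility: invmx is the identity on
   singular matrices. *)
Definition symmetry (C : numClosedFieldType) (d : nat) (J : 'M[C]_d) : Prop :=
  [/\ J \in unitmx, J = J ^t* & J = invmx J].

Definition Sym (C : numClosedFieldType) (k d : nat) (V : 'M[C]_d) : Prop :=
  exists J : 'I_k -> 'M[C]_d,
    (forall i, symmetry (J i)) /\ V = \prod_(i < k) J i.

Definition condition_P (C : numClosedFieldType) (r s : nat) (alpha beta : C)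
    : Prop :=
  (alpha ^+ r * beta ^+ s = -1 \/ alpha ^+ r * beta ^+ s = 1) /\
  (forall i j : nat, (i, j) <> (0%N, 0%N) ->
     alpha ^+ i * beta ^+ j = -1 \/ alpha ^+ i * beta ^+ j = 1 ->
     (r + s <= i + j)%N).

Definition expi (R : realType) (t : R) : R[i] := cos t +i* sin t.

(* Main.v *)
(* Write al, be for alpha, beta, and w = al be. Both the membership of V in
   Sym_3 and the disjunction of (a)-(d) are equivalent to
   |e^(i pi (r-1)/r) - 1| < |al - be|.

   V = J1 J2 J3 means that U = J1 V is a product of two symmetries, so the
   spectrum of U is stable under l |-> 1/l, while the relation
   (V - al)(V - be) = 0 makes it stable under l |-> -w/l, except at l = +-al and
   l = +-be. By condition (P) these two moves produce an orbit (-w)^k l, k < r,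
   and each eigenvalue satisfies |l^2 - w| <= |al - be| because <x J1, x> is
   real. As w^2 has order exactly r, the numbers l^2 w^(2k) / w run through a
   coset of the r-th roots of unity, which has to meet the arc of half-width
   pi/r around -1. The inequality is strict because equality contradicts (P).

   Conversely, in dimension 2 any unit l with |l^2 - w| <= |al - be| is an
   eigenvalue, together with -w/l, of diag(al, be) J for some symmetry J. Gluing
   r such blocks with l_(k+1) = -l_k / w gives a unitary matrix whose spectrum is
   invariant under conjugation, hence a product of two symmetries; the choice
   l_0 = 1 or l_0 = i, according to the sign of (-w)^r, makes the coset
   symmetric about the real axis, with its gap centred at -1. *)

(* perm.Sym would shadow Defs.Sym, so perm is imported before Defs. *)
From mathcomp Require Import perm spectral sesquilinear.
Require Import Defs.
From HB Require Import structures.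
From mathcomp Require Import all_boot all_order all_algebra.
From mathcomp Require Import complex.
From mathcomp Require Import reals trigo.
From mathcomp Require Import ring lra zify.

Set Implicit Arguments.
Unset Strict Implicit.
Unset Printing Implicit Defensive.

Import Order.TTheory GRing.Theory Num.Theory.
Local Open Scope ring_scope.
Local Open Scope sesquilinear_scope.

(** * Unit complex numbers, adjoints and symmetries *)

Lemma conj_unit (C : numClosedFieldType) (z : C) : `|z| = 1 -> z^* = z^-1.
Proof. by move=> z1; rewrite invC_norm z1 expr1n invr1 mul1r. Qed.

Lemma unit_neq0 (C : numClosedFieldType) (z : C) : `|z| = 1 -> z != 0.
Proof. by move=> z1; rewrite -normr_eq0 z1 oner_eq0. Qed.

Lemma symmetryP (C : numClosedFieldType) d (J : 'M[C]_d) :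
  symmetry J <-> J ^t* = J /\ J *m J = 1%:M.
Proof.
split=> [[Ju Jh Ji]|[Jh JJ]]; last first.
  have [Ju _] := mulmx1_unit JJ.
  by split=> //; rewrite -[RHS]mulmx1 -JJ mulmxA mulVmx ?mul1mx.
by split; [rewrite -Jh | rewrite {2}Ji mulmxV].
Qed.

Lemma mulmxCt (C : numClosedFieldType) m n p (A : 'M[C]_(m, n))
  (B : 'M[C]_(n, p)) : (A *m B) ^t* = B ^t* *m A ^t*.
Proof. by rewrite trmx_mul map_mxM. Qed.

Lemma dotC_gt0 (C : numClosedFieldType) n (x : 'rV[C]_n) :
  x != 0 -> 0 < (x *m x ^t*) 0 0.
Proof. by move=> x0; have := dotmx_is_dotmx x0; rewrite dotmxE. Qed.

Lemma dotC_ge0 (C : numClosedFieldType) n (x : 'rV[C]_n) :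
  0 <= (x *m x ^t*) 0 0.
Proof.
by have [->|/dotC_gt0/ltW//] := eqVneq x 0; rewrite mul0mx mxE.
Qed.

Lemma Sym3P (C : numClosedFieldType) d (V : 'M[C]_d) :
  Sym 3 V <-> exists J1 J2 J3 : 'M[C]_d,
    [/\ symmetry J1, symmetry J2, symmetry J3 & V = J1 *m J2 *m J3].
Proof.
split=> [[J [Js ->]]|[J1 [J2 [J3 [s1 s2 s3 ->]]]]].
  exists (J ord0), (J (lift ord0 ord0)), (J (lift ord0 (lift ord0 ord0))).
  by split=> //; rewrite !big_ord_recl big_ord0 mulr1 mulrA.
exists (fun i : 'I_3 => nth J1 [:: J1; J2; J3] i); split.
  by case=> [[|[|[|]]]].
by rewrite !big_ord_recl big_ord0 /= mulr1 mulrA.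
Qed.

(** * The spectrum of [U = J1 V] when [V = J1 J2 J3] *)

Section Spectrum.
Variables (C : numClosedFieldType) (r : nat) (al be : C).
Hypotheses (al1 : `|al| = 1) (be1 : `|be| = 1).

Let V : 'M[C]_(r + r) := block_mx al%:M 0 0 be%:M.
Let V' : 'M[C]_(r + r) := block_mx al^-1%:M 0 0 be^-1%:M.
Let al0 := unit_neq0 al1.
Let be0 := unit_neq0 be1.

Lemma adj_V : V ^t* = V'.
Proof.
rewrite /V tr_block_mx map_block_mx !tr_scalar_mx !map_scalar_mx !trmx0 !map_mx0.
by rewrite /= !conj_unit.
Qed.

Lemma V_mulV' : V *m V' = 1%:M.
Proof.
rewrite mulmx_block !mulmx0 !mul0mx !add0r addr0 -!scalar_mxM !divff //.
by rewrite -scalar_mx_block.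
Qed.

(* The quadratic relation (V - al)(V - be) = 0, divided by V. *)
Lemma V_quadratic : V = (al + be)%:M - (al * be) *: V'.
Proof.
rewrite [(al + be)%:M]scalar_mx_block scale_block_mx !scaler0 !scale_scalar_mx.
rewrite opp_block_mx add_block_mx oppr0 !addr0 -!raddfB /=.
congr (block_mx _%:M 0 0 _%:M).
  by field.
by field.
Qed.
End Spectrum.

Section Necessity.
Variables (C : numClosedFieldType) (r : nat) (al be : C).
Hypotheses (al1 : `|al| = 1) (be1 : `|be| = 1).
Variables J1 J2 J3 : 'M[C]_(r + r).
Hypotheses (s1 : symmetry J1) (s2 : symmetry J2) (s3 : symmetry J3).

Let V : 'M[C]_(r + r) := block_mx al%:M 0 0 be%:M.
Let V' : 'M[C]_(r + r) := block_mx al^-1%:M 0 0 be^-1%:M.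
Let al0 := unit_neq0 al1.
Let be0 := unit_neq0 be1.
Hypothesis VJ : V = J1 *m J2 *m J3.
Let U := J1 *m V.

Let J1K : J1 *m J1 = 1%:M. Proof. by have [] := (symmetryP J1).1 s1. Qed.
Let J2K : J2 *m J2 = 1%:M. Proof. by have [] := (symmetryP J2).1 s2. Qed.
Let J3K : J3 *m J3 = 1%:M. Proof. by have [] := (symmetryP J3).1 s3. Qed.
Let J1h : J1 ^t* = J1. Proof. by have [] := (symmetryP J1).1 s1. Qed.

Let UJ : U = J2 *m J3.
Proof. by rewrite /U VJ !mulmxA J1K mul1mx. Qed.

Lemma eigen_norm (x : 'rV[C]_(r + r)) l : x *m U = l *: x -> x != 0 -> `|l| = 1.
Proof.
move=> xU x0; have xx := dotC_gt0 x0.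
have UU : U *m U ^t* = 1%:M.
  rewrite /U mulmxCt adj_V // J1h -/V' mulmxA -[J1 *m V *m V']mulmxA.
  by rewrite V_mulV' // mulmx1.
have : (x *m U) *m (x *m U) ^t* = x *m x ^t*.
  by rewrite mulmxCt mulmxA -[x *m U *m _]mulmxA UU mulmx1.
rewrite xU linearZ /= map_mxZ /= -scalemxAl -scalemxAr scalerA -normCK.
move=> /matrixP/(_ 0 0); rewrite mxE => E.
apply/eqP; rewrite -sqrp_eq1 //; apply/eqP.
by apply: (mulIf (lt0r_neq0 xx)); rewrite E mul1r.
Qed.

(** Conjugation by [J3] turns [U = J2 J3] into its inverse [J3 J2]. *)
Lemma eigen_inv l : eigenvalue U l -> eigenvalue U l^-1.
Proof.
move=> /eigenvalueP[x xU x0]; have l0 := unit_neq0 (eigen_norm xU x0).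
have xJ : x *m J2 = l *: (x *m J3).
  by rewrite scalemxAl -xU UJ -!mulmxA J3K mulmx1.
apply/eigenvalueP; exists (x *m J3); last first.
  by apply: contra_neq x0 => x0; rewrite -[x]mulmx1 -J3K mulmxA x0 mul0mx.
have {1}-> : x *m J3 = l^-1 *: (x *m J2) by rewrite xJ scalerA mulVf ?scale1r.
by rewrite -scalemxAl UJ -mulmxA (mulmxA J2) J2K mul1mx.
Qed.

(** The span of [x] and [y = x J1] is invariant under [U]. If it is a plane, [U] has determinant
    [- al be] on it, which gives the second eigenvalue; if it is a line, [J1] acts on [x] by a sign
    and [x] is an eigenvector of [V]. *)
Lemma eigen_partner l : eigenvalue U l ->
  [\/ l ^+ 2 = al ^+ 2, l ^+ 2 = be ^+ 2 | eigenvalue U (- (al * be) / l)].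
Proof.
move=> /eigenvalueP[x xU x0]; have l0 := unit_neq0 (eigen_norm xU x0).
have xJ : x *m J1 = l *: (x *m V').
  by rewrite scalemxAl -xU /U -!mulmxA V_mulV' // mulmx1.
pose y := x *m J1.
have yU : y *m U = (al + be) *: x - (al * be / l) *: y.
  rewrite /y /U !mulmxA -(mulmxA x) J1K mulmx1 /V V_quadratic // mulmxBr.
  rewrite mul_mx_scalar -scalemxAr xJ scalerA; congr (_ - _ *: _).
  by rewrite mulfVK.
have [l2|l2] := eqVneq (l + al * be / l) 0.
  apply: Or33; have -> : - (al * be) / l = l.
    by rewrite mulNr; apply/esym/eqP; rewrite -addr_eq0 l2.
  by apply/eigenvalueP; exists x.
(* The coefficient that makes [y - t *: x], if nonzero, an eigenvector for [- (al * be) / l]. *)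
pose t := (al + be) / (l + al * be / l).
have [yt|yt] := eqVneq (y - t *: x) 0; last first.
  apply: Or33; apply/eigenvalueP; exists (y - t *: x) => //.
  rewrite mulmxBl yU -scalemxAl xU scalerBr !scalerA.
  have -> : al + be = t * (l + al * be / l) by rewrite /t mulfVK.
  apply/matrixP => i j; rewrite !mxE; ring.
have {}yt : x *m J1 = t *: x by apply/eqP; rewrite -subr_eq0 yt.
have t2 : t ^+ 2 = 1.
  have E : t ^+ 2 *: x = x.
    by rewrite expr2 -scalerA -yt -[RHS]mulmx1 -J1K mulmxA yt -scalemxAl yt.
  apply/eqP; rewrite -subr_eq0; have := congr1 (fun z => z - x) E.
  rewrite subrr -{2}[x]scale1r -scalerBl => /eqP.
  by rewrite scaler_eq0 (negPf x0) orbF.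
have xV : t *: (x *m V) = l *: x.
  by rewrite -xU /U mulmxA yt scalemxAl.
have {}xV : x *m V = (t * l) *: x.
  by rewrite -scalerA -xV scalerA -expr2 t2 scale1r.
rewrite -[x]hsubmxK mul_row_block !mulmx0 addr0 add0r !mul_mx_scalar in xV.
move: xV; rewrite scale_row_mx => /eq_row_mx[x1 x2].
have tl2 : (t * l) ^+ 2 = l ^+ 2 by rewrite exprMn t2 mul1r.
have [lx|lx] := eqVneq (lsubmx x) 0; last first.
  apply: Or31; rewrite -tl2; congr (_ ^+ 2); apply/eqP; rewrite -subr_eq0.
  move/eqP: x1; rewrite eq_sym -subr_eq0 -scalerBl scaler_eq0 (negPf lx).
  by rewrite orbF.
apply: Or32; rewrite -tl2; congr (_ ^+ 2); apply/eqP; rewrite -subr_eq0.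
move/eqP: x2; rewrite eq_sym -subr_eq0 -scalerBl scaler_eq0 => /orP[//|/eqP rx].
by move: x0; rewrite -[x]hsubmxK lx rx row_mx0 eqxx.
Qed.

(* The real number is <x J1, x> for a unit eigenvector x. *)
Lemma eigen_chord l : eigenvalue U l ->
  exists2 p : C, 0 <= p <= 1 & l * (p / al + (1 - p) / be) \is Num.real.
Proof.
move=> /eigenvalueP[x xU x0]; have xx := dotC_gt0 x0.
have xJ : x *m J1 = l *: (x *m V').
  by rewrite scalemxAl -xU /U -!mulmxA V_mulV' // mulmx1.
set xx_ : C := (x *m x ^t*) 0 0 in xx.
pose n1 : C := (lsubmx x *m (lsubmx x) ^t*) 0 0.
pose n2 : C := (rsubmx x *m (rsubmx x) ^t*) 0 0.
have xE : row_mx (lsubmx x) (rsubmx x) = x := hsubmxK x.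
have n12 : xx_ = n1 + n2.
  by rewrite /xx_ -{1 2}xE tr_row_mx map_col_mx mul_row_col mxE.
have E : (x *m J1 *m x ^t*) 0 0 = l * (n1 / al + n2 / be).
  rewrite xJ -{1 2}xE mul_row_block !mulmx0 addr0 add0r !mul_mx_scalar.
  rewrite tr_row_mx map_col_mx -scalemxAl mul_row_col -!scalemxAl.
  rewrite mxE mxE [X in X + _]mxE [X in _ + X]mxE.
  by rewrite -/n1 -/n2 [n1 / _]mulrC [n2 / _]mulrC.
exists (n1 / xx_).
  apply/andP; split; first by rewrite divr_ge0 ?dotC_ge0 ?(ltW xx).
  by rewrite (ler_pdivrMr _ _ xx) mul1r n12 lerDl dotC_ge0.
have -> : l * (n1 / xx_ / al + (1 - n1 / xx_) / be) =
    (x *m J1 *m x ^t*) 0 0 / xx_.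
  have x'0 := lt0r_neq0 xx.
  rewrite E; have -> : n2 = xx_ - n1 by rewrite n12 addrC addKr.
  by field; rewrite x'0 al0 be0.
apply: rpredM; last by rewrite rpredV realE ltW.
rewrite CrealE; apply/eqP.
have <- : ((x *m J1 *m x ^t*) ^t*) 0 0 = ((x *m J1 *m x ^t*) 0 0)^*.
  by rewrite !mxE.
by rewrite !mulmxCt J1h trmxCK mulmxA.
Qed.

End Necessity.

(** * Realising a prescribed spectrum by symmetries *)

Lemma symmetry_conj (C : numClosedFieldType) d (W J : 'M[C]_d) :
  W \is unitarymx -> symmetry J -> symmetry (W ^t* *m J *m W).
Proof.
move=> /unitarymxP WW /symmetryP[Jh JJ]; apply/symmetryP; split.
  by rewrite !mulmxCt trmxCK Jh mulmxA.
rewrite !mulmxA -[W ^t* *m J *m W *m _]mulmxA WW mulmx1.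
by rewrite -[W ^t* *m J *m J]mulmxA JJ mulmx1 (mulmx1C WW).
Qed.

(** For D the diagonal matrix and [P] the permutation matrix of [s], P D P is the adjoint of D.
    Hence P D is a symmetry, and D = P (P D). *)
Lemma diag_Sym2 (C : numClosedFieldType) d (e : 'rV[C]_d) (s : 'I_d -> 'I_d) :
  involutive s -> (forall i, e 0 (s i) = (e 0 i)^*) ->
  (forall i, `|e 0 i| = 1) ->
  exists J1 J2, [/\ symmetry J1, symmetry J2 & diag_mx e = J1 *m J2].
Proof.
move=> sK es e1; pose P : 'M[C]_d := perm_mx (perm (inv_inj sK)).
have PE i j : P i j = (s i == j)%:R by rewrite !mxE permE.
have PP : P *m P = 1%:M.
  rewrite -perm_mxM -perm_mx1; congr perm_mx; apply/perm.permP => i.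
  by rewrite permM perm1 !permE /= sK.
have Ph : P ^t* = P.
  apply/matrixP => i j; rewrite 2!mxE !PE conjC_nat -{2}[j]sK (inj_eq (inv_inj sK)).
  by rewrite eq_sym.
have DD : diag_mx e *m (diag_mx e) ^t* = 1%:M.
  rewrite tr_diag_mx map_diag_mx mulmx_diag -diag_const_mx; congr diag_mx.
  by apply/rowP => i; rewrite !mxE -normCK e1 expr1n.
have PDh : (P *m diag_mx e) ^t* = P *m diag_mx e.
  rewrite mulmxCt Ph tr_diag_mx map_diag_mx; apply/matrixP => i j.
  rewrite mul_diag_mx mul_mx_diag !mxE !permE /=.
  by case: eqP => [<-|_]; rewrite ?mulr0 ?mul0r // es mulr1 mul1r.
exists P, (P *m diag_mx e); split; [exact/symmetryP| |by rewrite mulmxA PP mul1mx].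
apply/symmetryP; split=> //.
by rewrite -{2}PDh mulmxCt Ph mulmxA -[P *m _ *m _]mulmxA DD mulmx1.
Qed.

Section BlockDiag.
Variables (C : numClosedFieldType) (r : nat).
Implicit Types a b c e : 'I_r -> C.

Definition dmx a : 'M[C]_r := diag_mx (\row_i a i).

Lemma dmxM a b : dmx a *m dmx b = dmx (fun i => a i * b i).
Proof.
by rewrite mulmx_diag; congr diag_mx; apply/rowP => i; rewrite !mxE.
Qed.

Lemma dmxD a b : dmx a + dmx b = dmx (fun i => a i + b i).
Proof. by rewrite -raddfD; congr diag_mx; apply/rowP => i; rewrite !mxE. Qed.

Lemma dmxC z : dmx (fun=> z) = z%:M.
Proof. by rewrite -diag_const_mx; congr diag_mx; apply/rowP => i; rewrite !mxE. Qed.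

Lemma eq_dmx a b : a =1 b -> dmx a = dmx b.
Proof. by move=> ab; congr diag_mx; apply/rowP => i; rewrite !mxE. Qed.

Lemma dmx_adj a : (dmx a) ^t* = dmx (fun i => (a i)^*).
Proof.
by rewrite tr_diag_mx map_diag_mx; congr diag_mx; apply/rowP => i; rewrite !mxE.
Qed.

(* A field of 2 x 2 matrices [[a i, b i], [c i, e i]] indexed by i < r. *)
Definition bdmx a b c e := block_mx (dmx a) (dmx b) (dmx c) (dmx e).

Lemma bdmxM a b c e a' b' c' e' :
  bdmx a b c e *m bdmx a' b' c' e' =
  bdmx (fun i => a i * a' i + b i * c' i) (fun i => a i * b' i + b i * e' i)
       (fun i => c i * a' i + e i * c' i) (fun i => c i * b' i + e i * e' i).
Proof. by rewrite mulmx_block !dmxM !dmxD. Qed.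

Lemma bdmx_adj a b c e : (bdmx a b c e) ^t* =
  bdmx (fun i => (a i)^*) (fun i => (c i)^*) (fun i => (b i)^*) (fun i => (e i)^*).
Proof. by rewrite tr_block_mx map_block_mx !dmx_adj. Qed.

Lemma eq_bdmx a b c e a' b' c' e' : a =1 a' -> b =1 b' -> c =1 c' -> e =1 e' ->
  bdmx a b c e = bdmx a' b' c' e'.
Proof. by move=> *; congr block_mx; apply: eq_dmx. Qed.

Lemma bdmx_scalar z y :
  bdmx (fun=> z) (fun=> 0) (fun=> 0) (fun=> y) = block_mx z%:M 0 0 y%:M.
Proof. by rewrite /bdmx !dmxC raddf0. Qed.

End BlockDiag.

(** In the i-th plane U is diag(l i, m i) turned by a rotation, and [J3] is U^-1 V. In the rotated
    basis, the reality hypothesis makes the diagonal of [J3] real and l m = - al be makes its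
    off-diagonal entries conjugate. So V = U J3, with U split by [diag_Sym2]. *)
Lemma Sym3_of_spectrum (C : numClosedFieldType) (r : nat) (al be : C)
    (l m p : 'I_r -> C) (s : 'I_(r + r) -> 'I_(r + r)) :
  `|al| = 1 -> `|be| = 1 -> (forall i, `|l i| = 1) ->
  (forall i, l i * m i = - (al * be)) -> (forall i, 0 <= p i <= 1) ->
  (forall i, l i * (p i / al + (1 - p i) / be) \is Num.real) ->
  let e := row_mx (\row_i l i) (\row_i m i) in
  involutive s -> (forall i, e 0 (s i) = (e 0 i)^*) ->
  Sym 3 (block_mx (al%:M : 'M_r) 0 0 (be%:M : 'M_r)).
Proof.
move=> al1 be1 l1 lm p01 lpR e sK es.
have al0 := unit_neq0 al1; have be0 := unit_neq0 be1.
have l0 i := unit_neq0 (l1 i).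
have mE i : m i = - (al * be) / l i by rewrite -(lm i) mulrC mulKf.
have m1 i : `|m i| = 1.
  by rewrite mE normrM normrN normfV normrM al1 be1 l1 invr1 !mulr1.
set V := block_mx _ _ _ _.
pose a i := sqrtC (p i); pose b i := sqrtC (1 - p i).
have aR i : (a i)^* = a i.
  by apply: conj_Creal; rewrite realE sqrtC_ge0; case/andP: (p01 i) => ->.
have bR i : (b i)^* = b i.
  apply: conj_Creal; rewrite realE sqrtC_ge0 subr_ge0.
  by case/andP: (p01 i) => _ ->.
have a2 i : a i * a i = p i by rewrite -expr2 sqrtCK.
have b2 i : b i * b i = 1 - p i by rewrite -expr2 sqrtCK.
pose W := bdmx a b (fun i => - b i) a.
have WW : W *m W ^t* = 1%:M.
  rewrite bdmx_adj bdmxM [RHS]scalar_mx_block -bdmx_scalar.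
  apply: eq_bdmx => i; rewrite ?rmorphN /= ?aR ?bR ?mulrNN ?a2 ?b2; ring.
pose D := bdmx l (fun=> 0) (fun=> 0) m.
have De : D = diag_mx e.
  rewrite diag_mx_row /D /bdmx -[in RHS](raddf0 (@diag_mx C r)).
  by congr block_mx; congr diag_mx; apply/rowP=> i; rewrite !mxE.
have e1 i : `|e 0 i| = 1.
  by rewrite /e mxE; case: (split i) => j; rewrite mxE.
have [J1 [J2 [s1 s2 DJ]]] := diag_Sym2 sK es e1.
have DD : D *m D ^t* = 1%:M.
  rewrite bdmx_adj bdmxM [RHS]scalar_mx_block -bdmx_scalar.
  by apply: eq_bdmx => i; rewrite ?conjC0 ?mulr0 ?mul0r ?addr0 ?add0r -?normCK
    ?l1 ?m1 ?expr1n.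
have VE : V = bdmx (fun=> al) (fun=> 0) (fun=> 0) (fun=> be) by rewrite bdmx_scalar.
have HX i : (l i)^-1 * (a i * a i * al + b i * b i * be) =
    l i * (a i * a i / al + b i * b i / be).
  rewrite !a2 !b2; have := lpR i; rewrite CrealE => /eqP <-.
  rewrite -b2 -a2 !(rmorphM, rmorphD, fmorphV) /= aR bR.
  by rewrite (conj_unit al1) (conj_unit be1) (conj_unit (l1 i)) !invrK.
(* [K] is [J3] in the basis where U is diagonal. *)
pose K := D ^t* *m W *m V *m W ^t*.
have Kh : K ^t* = K.
  rewrite /K /D /W VE !bdmx_adj !bdmxM bdmx_adj.
  apply: eq_bdmx => i /=; rewrite !(rmorphD, rmorphM, rmorphN, conjC0) /=;
    rewrite !conjCK ?aR ?bR !(conj_unit al1, conj_unit be1, conj_unit (l1 i),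
      conj_unit (m1 i)) ?mE.
  - by apply: (eq_trans _ (eq_trans (esym (HX i)) _)); field; rewrite ?l0 ?al0 ?be0.
  - by field; rewrite ?l0 ?al0 ?be0.
  - by field; rewrite ?l0 ?al0 ?be0.
  - apply/oppr_inj.
    by apply: (eq_trans _ (eq_trans (HX i) _)); field; rewrite ?l0 ?al0 ?be0.
have W'W := mulmx1C WW.
pose J3 := W ^t* *m D ^t* *m W *m V.
have J3K : J3 = W ^t* *m K *m W.
  by rewrite /J3 /K !mulmxA -[_ *m W ^t* *m W]mulmxA W'W mulmx1.
have VV : V *m V ^t* = 1%:M by rewrite adj_V // V_mulV'.
have J3h : J3 ^t* = J3 by rewrite J3K mulmxCt (mulmxCt (W ^t*) K) trmxCK Kh mulmxA.
apply/Sym3P; exists (W ^t* *m J1 *m W), (W ^t* *m J2 *m W), J3; split.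
- exact/symmetry_conj/s1/unitarymxP.
- exact/symmetry_conj/s2/unitarymxP.
- apply/symmetryP; split=> //; rewrite -{2}J3h /J3 !mulmxCt !trmxCK !mulmxA.
  rewrite -[_ *m V *m _]mulmxA VV mulmx1 -[_ *m W *m _]mulmxA WW mulmx1.
  by rewrite -[_ *m _ *m D]mulmxA (mulmx1C DD) mulmx1.
rewrite /J3 !mulmxA -[_ *m W *m W ^t*]mulmxA WW mulmx1.
rewrite -[_ *m W *m W ^t*]mulmxA WW mulmx1.
rewrite -[W ^t* *m J1 *m J2]mulmxA -DJ -De -[_ *m D *m _]mulmxA DD mulmx1.
by rewrite W'W mul1mx.
Qed.

Local Open Scope complex_scope.

(** * Chords and angles on the unit circle *)

Section UnitCircle.
Variable R : realType.
Implicit Types (x y u v al be l : R[i]) (s t : R).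

(** Squared modulus in [R] rather than [R[i]], within reach of [lra] and [nra]. *)
Definition sqn x : R := complex.Re x ^+ 2 + complex.Im x ^+ 2.

Lemma ler_norm_sqn x y : (`|x| <= `|y|) = (sqn x <= sqn y).
Proof. by rewrite !normc_def lecR ler_sqrt // addr_ge0 ?sqr_ge0. Qed.

Lemma sqn_unit x : `|x| = 1 -> sqn x = 1.
Proof. by move=> x1; apply: complexI; rewrite add_Re2_Im2 x1 expr1n. Qed.

Lemma unit_sqn x : sqn x = 1 -> `|x| = 1.
Proof. by rewrite normc_def -/(sqn x) => ->; rewrite sqrtr1. Qed.

Lemma sqn_sub1 u : `|u| = 1 -> sqn (u - 1) = 2 - 2 * complex.Re u.
Proof. by move/sqn_unit; case: u => a b; rewrite /sqn /= => ab; nra. Qed.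

Lemma ler_norm_sub1 u v : `|u| = 1 -> `|v| = 1 ->
  (`|u - 1| <= `|v - 1|) = (complex.Re v <= complex.Re u).
Proof. by move=> u1 v1; rewrite ler_norm_sqn !sqn_sub1 //; apply/idP/idP; lra. Qed.

Lemma divr_sub1 x y : `|y| = 1 -> `|x / y - 1| = `|x - y|.
Proof.
move=> y1; have y0 := unit_neq0 y1.
by rewrite -[RHS]divr1 -[in RHS]y1 -normf_div mulrBl divff.
Qed.

(** The squared moduli differ by 4 Im(l/al) Im(l/be). The inequality thus says that the segment from
    l/al to l/be meets the real axis. *)
Lemma chordE al be l : `|al| = 1 -> `|be| = 1 -> `|l| = 1 ->
  (`|l ^+ 2 - al * be| <= `|al - be|) =
  (complex.Im (l / al) * complex.Im (l / be) <= 0).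
Proof.
move=> al1 be1 l1; rewrite ler_norm_sqn -!conj_unit //.
move: (sqn_unit al1) (sqn_unit be1) (sqn_unit l1).
case: al {al1} => a1 a2; case: be {be1} => b1 b2; case: l {l1} => l1 l2.
rewrite /sqn expr2 /= => Na Nb Nl.
set N := (X in (X <= _) = _); set M := (X in (_ <= X) = _).
set A := _ + _ * a1; set B := _ + _ * b1.
have -> : N = M + 4 * (A * B).
  have -> : N = (l1 ^+ 2 + l2 ^+ 2) ^+ 2 + (a1 ^+ 2 + a2 ^+ 2) * (b1 ^+ 2 + b2 ^+ 2)
     + 4 * (A * B) - 2 * (l1 ^+ 2 + l2 ^+ 2) * (a1 * b1 + a2 * b2).
    by rewrite /N /A /B; ring.
  have -> : M = (a1 ^+ 2 + a2 ^+ 2) + (b1 ^+ 2 + b2 ^+ 2) - 2 * (a1 * b1 + a2 * b2).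
    by rewrite /M; ring.
  by rewrite Na Nb Nl; ring.
by apply/idP/idP; lra.
Qed.

Lemma real_comb (p : R) x y : (p%:C * x + (1 - p%:C) * y \is Num.real) =
  (p * complex.Im x + (1 - p) * complex.Im y == 0).
Proof.
case: x y => [x1 x2] [y1 y2] /=.
have -> : p%:C * (x1 +i* x2) + (1 - p%:C) * (y1 +i* y2) =
    (p * x1 + (1 - p) * y1) +i* (p * x2 + (1 - p) * y2).
  by apply/eqP; rewrite eq_complex /=; apply/andP; split; apply/eqP; ring.
exact: complex_real.
Qed.

Lemma chord_le al be l p : `|al| = 1 -> `|be| = 1 -> `|l| = 1 ->
  0 <= p <= 1 -> l * (p / al + (1 - p) / be) \is Num.real ->
  `|l ^+ 2 - al * be| <= `|al - be|.
Proof.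
move=> al1 be1 l1 p01; rewrite chordE //.
have -> : l * (p / al + (1 - p) / be) = p * (l / al) + (1 - p) * (l / be) by ring.
have -> : p = (complex.Re p)%:C.
  by rewrite RRe_real // realE; case/andP: p01 => ->.
rewrite real_comb => /eqP; move: p01; case: p => p1 p2.
rewrite !lecE /= => /andP[/andP[_ p10] /andP[_ p11]].
move: (complex.Im _) (complex.Im _) => B A E.
(* As p1 A + (1 - p1) B = 0, only minus a weighted mean of squares remains. *)
have -> : A * B = (p1 * A + (1 - p1) * B) * (A + B) -
    (p1 * A ^+ 2 + (1 - p1) * B ^+ 2) by ring.
by rewrite E mul0r sub0r oppr_le0 addr_ge0 // mulr_ge0 ?sqr_ge0 // subr_ge0.
Qed.

Lemma le_chord al be l : `|al| = 1 -> `|be| = 1 -> `|l| = 1 ->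
  `|l ^+ 2 - al * be| <= `|al - be| ->
  exists2 p : R[i], 0 <= p <= 1 & l * (p / al + (1 - p) / be) \is Num.real.
Proof.
move=> al1 be1 l1; rewrite chordE // => AB.
have E p : l * (p / al + (1 - p) / be) = p * (l / al) + (1 - p) * (l / be) by ring.
suff [p p01 pE] : exists2 p : R, 0 <= p <= 1 &
    p * complex.Im (l / al) + (1 - p) * complex.Im (l / be) = 0.
  exists p%:C; first by case/andP: p01 => ? ?; rewrite !lecR; apply/andP.
  by rewrite E real_comb pE.
move: (complex.Im (l / al)) (complex.Im (l / be)) AB => A B AB.
have [AeB|AB0] := eqVneq (A - B) 0.
  (* A = B and A B <= 0 force both to vanish, so any weight serves. *)
  by exists 0; [lra | have -> : B = A by lra]; nra.
have AB2 : 0 < (A - B) ^+ 2 by rewrite exprn_even_gt0.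
(* This is -B / (A - B), put over a positive denominator. *)
exists (- B * (A - B) / (A - B) ^+ 2).
  apply/andP; split; first by rewrite divr_ge0 ?(ltW AB2) //; nra.
  by rewrite ler_pdivrMr // mul1r; nra.
by field.
Qed.

Lemma expi_norm t : `|expi t| = 1.
Proof. by apply: unit_sqn; rewrite /sqn /= cos2Dsin2. Qed.

Lemma expiD s t : expi (s + t) = expi s * expi t.
Proof.
rewrite /expi cosD sinD.
by apply/eqP; rewrite eq_complex /=; apply/andP; split; apply/eqP; ring.
Qed.

Lemma expiX n t : expi t ^+ n = expi (n%:R * t).
Proof.
elim: n => [|n IH]; first by rewrite mul0r /expi cos0 sin0.
by rewrite exprS IH -expiD -natr1 mulrDl mul1r addrC.
Qed.

Lemma unit_polar u : `|u| = 1 ->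
  exists2 t : R, 0 <= t <= pi & u = expi t \/ u = expi (- t).
Proof.
move/sqn_unit; case: u => a b; rewrite /sqn /= => ab.
have a1 : -1 <= a <= 1 by apply/andP; split; nra.
exists (acos a); first by rewrite acos_ge0 ?acos_lepi.
rewrite /expi sinN cosN acosK ?in_itv //= sin_acos //.
have -> : 1 - a ^+ 2 = b ^+ 2 by lra.
rewrite sqrtr_sqr; have [b0|b0] := leP 0 b.
  by left; rewrite ger0_norm.
by right; rewrite ltr0_norm // opprK.
Qed.

Lemma ler_cos s t : 0 <= s -> s <= t -> t <= pi -> cos t <= cos s.
Proof.
move=> s0 st tpi; rewrite leNgt; apply/negP => h.
have := h; rewrite ltr_cos ?in_itv /=; first by lra.
  by apply/andP; split; lra.
by apply/andP; split; lra.
Qed.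

End UnitCircle.

(** * How close to -1 a coset of the r-th roots of unity must come *)

Section Gap.
Variables (R : realType) (r : nat).
Hypothesis r_gt0 : (0 < r)%N.
Implicit Types u : R[i].

(** An end of the arc of half-width pi/r centred at -1. *)
Definition gap : R[i] := expi ((r%:R - 1) / r%:R * pi).

Let r0 : (0 : R) < r%:R. Proof. by rewrite ltr0n. Qed.

Let pir : (0 <= (pi : R) / r%:R <= (pi : R)).
Proof.
apply/andP; split; first by rewrite divr_ge0 ?pi_ge0.
by rewrite ler_pdivrMr // ler_peMr ?pi_ge0 // ler1n.
Qed.

Lemma gap_Re : complex.Re gap = - cos (pi / r%:R).
Proof.
rewrite /gap /expi /=; have -> : (r%:R - 1) / r%:R * pi = - (pi / r%:R) + pi :> R.
  by field; rewrite lt0r_neq0.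
by rewrite cosDpi cosN.
Qed.

(** Rotating by a multiple of 2 pi/r brings [- u] within angle pi/r of 1, hence [u] within pi/r of
    -1. *)
Lemma gap_le_root u : `|u| = 1 ->
  exists2 z : R[i], z ^+ r = 1 & `|gap - 1| <= `|u * z - 1|.
Proof.
move=> u1; have [t t0 ut] : exists2 t : R, 0 <= t & - u = expi t.
  have [|t /andP[t0 tpi] [->|->]] := @unit_polar R (- u); first by rewrite normrN.
    by exists t.
  exists (- t + pi *+ 2); first by have := pi_ge0 R; rewrite mulr2n; lra.
  by rewrite /expi cosD2pi sinD2pi.
(* Truncation after adding 1/2 rounds [t / a] to the nearest natural number; hence the choice of [t]
   nonnegative. *)
pose a : R := 2 * pi / r%:R; pose k := Num.truncn (t / a + 2^-1).
have a0 : 0 < a by rewrite divr_gt0 ?mulr_gt0 ?pi_gt0.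
have : k%:R <= t / a + 2^-1 < k.+1%:R.
  apply: truncn_itv; apply: addr_ge0; last by rewrite invr_ge0 ler0n.
  exact: divr_ge0 t0 (ltW a0).
rewrite -[in X in _ < X]natr1 => /andP[k1 k2].
have aE : a = 2 * (pi / r%:R) by rewrite /a mulrA.
have {}k2 : `|t - k%:R * a| <= pi / r%:R.
  have -> : t - k%:R * a = (t / a - k%:R) * a by rewrite mulrBl divfK ?lt0r_neq0.
  case/andP: pir; move: (t / a) (k%:R : R) k1 k2 => y q k1 k2 h0 _.
  rewrite aE; move: (pi / r%:R) h0 => h h0.
  have H1 : 0 <= (y + 2^-1 - q) * h by rewrite mulr_ge0 // subr_ge0.
  have H2 : 0 <= (q + 1 - (y + 2^-1)) * h by rewrite mulr_ge0 // subr_ge0 (ltW k2).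
  by rewrite ler_norml; apply/andP; split; lra.
exists (expi (- (k%:R * a))).
  rewrite expiX /a.
  have -> : r%:R * - (k%:R * (2 * pi / r%:R)) = - (pi *+ (2 * k)) :> R.
    by rewrite -(mulr_natl pi (2 * k)%N) natrM; field; rewrite lt0r_neq0.
  rewrite mulrnA /expi cosN sinN; elim: k {k1 k2} => [|k IH].
    by rewrite mulr0n cos0 sin0 oppr0.
  by rewrite mulrSr cosD2pi sinD2pi.
have -> : u = - expi t by rewrite -ut opprK.
rewrite mulNr -expiD ler_norm_sub1 ?normrN ?expi_norm // gap_Re /= lerN2.
rewrite -[X in _ <= X]cos_norm; apply: ler_cos => //; by case/andP: pir.
Qed.

(** The hypothesis says (-u)^r = -1, so r times the angle of -u is an odd multiple of pi, and -u is
    at angle at least pi/r from 1. *)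
Lemma root_le_gap u : u ^+ r = (-1) ^+ r.-1 -> `|u - 1| <= `|gap - 1|.
Proof.
move=> ur; have u1 : `|u| = 1.
  apply/eqP; rewrite -(@pexpr_eq1 _ _ r) // -normrX ur normrX.
  by rewrite normrN1 expr1n.
rewrite ler_norm_sub1 ?expi_norm // gap_Re.
have [|t /andP[t0 tpi] ut] := @unit_polar R (- u); first by rewrite normrN.
have Ru : complex.Re u = - cos t.
  by rewrite -[u]opprK; case: ut => ->; rewrite /expi /= ?cosN.
have rt : cos (r%:R * t) = -1.
  have : complex.Re ((- u) ^+ r) = -1.
    rewrite exprNn ur -{1}(prednK r_gt0) exprS -mulrA -exprMn mulrNN mulr1.
    by rewrite expr1n mulr1.
  by case: ut => ->; rewrite expiX /= ?mulrN ?cosN.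
rewrite Ru lerN2; case/andP: pir => pir0 pir1.
apply: ler_cos => //; rewrite leNgt; apply/negP; rewrite ltr_pdivlMr // => tr.
have := @cos_inj R (r%:R * t) pi.
rewrite rt cospi !in_itv /= => /(_ _ _ erefl) E.
have : r%:R * t = pi.
  by apply: E; rewrite ?pi_ge0 ?lexx // mulrC (ltW tr) mulr_ge0 // ltW.
by lra.
Qed.

End Gap.

(** * Condition (P), and membership in Sym_3 as the gap inequality *)

Section EqualMultiplicities.
Variables (R : realType) (r : nat) (al be : R[i]).
Hypotheses (r_gt1 : (1 < r)%N) (al1 : `|al| = 1) (be1 : `|be| = 1).
Hypotheses (albe : al <> be) (P : condition_P r r al be).

Local Notation w := (al * be).
Local Notation G := (gap R r).
Let V : 'M[R[i]]_(r + r) := block_mx al%:M 0 0 be%:M.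
Let al0 := unit_neq0 al1.
Let be0 := unit_neq0 be1.

Let r_gt0 : (0 < r)%N. Proof. exact: ltnW. Qed.
Let w0 : w != 0. Proof. by rewrite mulf_neq0. Qed.
Let w1 : `|w| = 1. Proof. by rewrite normrM al1 be1 mulr1. Qed.

(** Squaring merges the two signs of condition (P) into one equation. *)
Lemma condP_sqr i j : (0 < i + j)%N -> (al ^+ i * be ^+ j) ^+ 2 = 1 ->
  (r + r <= i + j)%N.
Proof.
move=> ij /eqP; rewrite sqrf_eq1 => E; apply: P.2.
  by case=> i0 j0; rewrite i0 j0 in ij.
by case/orP: E => /eqP ->; [right|left].
Qed.

Lemma wr_sign : w ^+ r = 1 \/ w ^+ r = -1.
Proof. by rewrite exprMn; case: P.1 => ->; [right|left]. Qed.

Lemma w2r : w ^+ (2 * r) = 1.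
Proof. by rewrite mulnC exprM; case: wr_sign => ->; rewrite ?sqrrN expr1n. Qed.

(** The order m of w^2 divides r, and (al^m be^m)^2 = 1 gives 2m >= 2r by condition (P). *)
Lemma w2_primitive : r.-primitive_root (w ^+ 2).
Proof.
have [|m mP mr] := @prim_order_exists _ r (w ^+ 2) r_gt0.
  by rewrite -exprM w2r.
suff -> : r = m by [].
have m0 := prim_order_gt0 mP.
apply/eqP; rewrite eqn_leq (dvdn_leq r_gt0 mr) andbT.
have : (r + r <= m + m)%N.
  apply: condP_sqr; first by rewrite addn_gt0 m0.
  by rewrite -exprMn exprAC prim_expr_order.
by rewrite !addnn leq_double.
Qed.

(** If w^r = 1, it is the square of al^(r/2) be^(r/2), whose exponents are too small for condition
    (P). *)
Lemma wr_even : ~~ odd r -> w ^+ r = -1.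
Proof.
move=> ro; case: wr_sign => // wr.
have r2 : r = (r./2 + r./2)%N by rewrite addnn halfK (negPf ro) subn0.
have : (r + r <= r./2 + r./2)%N.
  by apply: condP_sqr; rewrite -?r2 // -exprMn -exprM muln2 -addnn -r2.
by rewrite -r2; lia.
Qed.

Lemma gap_le_orbit u : `|u| = 1 ->
  exists2 k, (k < r)%N & `|G - 1| <= `|u * w ^+ (2 * k) - 1|.
Proof.
move=> u1; have [z zr le_z] := gap_le_root r_gt0 u1.
have [k zE] := prim_rootP w2_primitive zr.
by exists k => //; rewrite exprM -zE.
Qed.

Lemma gap_root : G ^+ (2 * r) = 1.
Proof.
rewrite expiX.
have -> : (2 * r)%:R * ((r%:R - 1) / r%:R * pi) = pi *+ (2 * r.-1) :> R.
  rewrite -(mulr_natl pi) !natrM -(subn1 r) natrB //.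
  by field; rewrite pnatr_eq0 -lt0n.
rewrite mulrnA; elim: (r.-1) => [|k IH]; first by rewrite mulr0n /expi cos0 sin0.
by rewrite mulrSr /expi cosD2pi sinD2pi.
Qed.

(* Equality would make al / be a 2r-th root of unity, hence +-w^k for some
   k < r, which condition (P) only allows for al = -be; but then
   |al - be| = 2 exceeds |G - 1|. *)
Lemma gap_lt : `|G - 1| <= `|al - be| -> `|G - 1| < `|al - be|.
Proof.
move=> le_G; rewrite lt_neqAle le_G andbT; apply/eqP => eqG.
have g1 : `|al / be| = 1 by rewrite normf_div al1 be1 divr1.
have G1 : `|G| = 1 by exact: expi_norm.
have gG : complex.Re (al / be) = complex.Re G.
  by apply/eqP; rewrite eq_le -!ler_norm_sub1 // divr_sub1 // eqG lexx.
have gr : ((al / be) ^+ 2) ^+ r = 1.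
  rewrite -exprM; have [->|->] : al / be = G \/ al / be = G^-1.
    rewrite -(conj_unit G1); move: (sqn_unit g1) (sqn_unit G1) gG.
    case: (al / be) (G) => [a b] [c e]; rewrite /sqn /= => ab ce ac.
    have /eqP : b ^+ 2 = e ^+ 2 by rewrite ac in ab; lra.
    rewrite ac eqf_sqr => /orP[/eqP->|/eqP->]; first by left.
    by right.
    exact: gap_root.
  by rewrite exprVn gap_root invr1.
have [k gk] := prim_rootP w2_primitive gr.
have k0 : k = 0%N :> nat.
  (* The number al^(r-k+1) be^(r-k-1) = (al/be) w^(r-k) has square w^(2k) w^(2(r-k)) = 1, so
     condition (P) gives 2(r-k) >= 2r. *)
  have := ltn_ord k; have : (r + r <= (r - k).+1 + (r - k).-1)%N.
    apply: condP_sqr; first by rewrite addSn.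
    have -> : (r - k).+1 = ((r - k).-1 + 2)%N by have := ltn_ord k; lia.
    have -> : al ^+ ((r - k).-1 + 2) * be ^+ (r - k).-1 = al / be * w ^+ (r - k).
      rewrite exprD mulrAC -exprMn -[in RHS](prednK (n := r - k)) ?subn_gt0 //.
      by rewrite [in RHS]exprSr; move: (w ^+ _) => z; field.
    rewrite exprMn gk -!exprM mulnC -exprD -mulnDl subnKC; last exact: ltnW.
    by rewrite mulnC w2r.
  by lia.
move: gk; rewrite k0 expr0 => /eqP; rewrite sqrf_eq1 => /orP[]/eqP g.
  by apply: albe; rewrite -[al](mulfVK be0) g mul1r.
have : complex.Re (al / be) = -1 by rewrite g.
have rR : (1 : R) < r%:R by rewrite ltr1n.
rewrite gG gap_Re // => /oppr_inj c1.
have : cos (pi / r%:R) < cos 0 :> R.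
  have r0 : (0 : R) < r%:R by lra.
  rewrite ltr_cos ?divr_gt0 ?pi_gt0 // in_itv /= ?lexx ?pi_ge0 //.
  apply/andP; split; first by rewrite divr_ge0 ?pi_ge0 ?(ltW r0).
  by rewrite (ler_pdivrMr _ _ r0) ler_peMr ?pi_ge0 ?(ltW rR).
by rewrite c1 cos0 ltxx.
Qed.

(* The map l |-> - w l = partner of l^-1 can only be blocked at l^-1 = +-al or
   +-be; starting the orbit at such a point, condition (P) delays the next
   blocked point until the r-th step. *)
Lemma spectrum_orbit (spec : R[i] -> Prop) :
  (exists l, spec l) -> (forall l, spec l -> l != 0) ->
  (forall l, spec l -> spec l^-1) ->
  (forall l, spec l ->
     [\/ l ^+ 2 = al ^+ 2, l ^+ 2 = be ^+ 2 | spec (- w / l)]) ->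
  exists2 l, spec l & forall k, (k < r)%N -> spec ((- w) ^+ k * l).
Proof.
move=> [l0 sl0] spec0 specV specP.
have step l : spec l -> l ^+ 2 * al ^+ 2 <> 1 -> l ^+ 2 * be ^+ 2 <> 1 ->
    spec (- w * l).
  move=> sl la lb; have l20 := expf_neq0 2 (spec0 _ sl).
  case: (specP _ (specV _ sl)) => [E|E|]; last by rewrite invrK.
    by case: la; rewrite -E exprVn mulfV.
  by case: lb; rewrite -E exprVn mulfV.
have sqrwl k l : ((- w) ^+ k * l) ^+ 2 = w ^+ k * w ^+ k * l ^+ 2.
  by rewrite exprMn exprAC sqrrN exprAC expr2.
pose special l := l ^+ 2 = al ^+ 2 \/ l ^+ 2 = be ^+ 2.
(* If the orbit of [l0] is blocked within r steps, the inverse of the blocked point is special. *)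
have [[l sl lP]|IH] : (exists2 l, spec l & special l) \/
    (forall k, (k <= r)%N -> spec ((- w) ^+ k * l0)); last first.
- by exists l0 => // k kr; apply/IH/ltnW.
- exists l => //; elim=> [|k IH] kr; first by rewrite expr0 mul1r.
  rewrite exprS -mulrA; apply: step; first exact/IH/ltnW.
    (* Being blocked here means (al^i be^j)^2 = 1 with i + j = 2k + 2, against k + 1 < r. *)
    rewrite sqrwl => E; suff: (r + r <= k.+1 + k.+1)%N by lia.
    case: lP => lE; rewrite lE in E.
      suff: (r + r <= k.+2 + k)%N by lia.
      by apply: condP_sqr => //; rewrite -E [w ^+ k]exprMn !exprS; ring.
    by apply: condP_sqr => //; rewrite -E [w ^+ k]exprMn !exprS; ring.
  rewrite sqrwl => E; suff: (r + r <= k.+1 + k.+1)%N by lia.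
  case: lP => lE; rewrite lE in E.
    by apply: condP_sqr => //; rewrite -E [w ^+ k]exprMn !exprS; ring.
  suff: (r + r <= k + k.+2)%N by lia.
  by apply: condP_sqr; rewrite ?addnS // -E [w ^+ k]exprMn !exprS; ring.
elim: (r) => [|n [IH|IH]]; [right => k|by left|].
  by rewrite leqn0 => /eqP->; rewrite expr0 mul1r.
pose z := (- w) ^+ n * l0; have sz : spec z by exact: IH.
have z0 := expf_neq0 2 (spec0 _ sz).
have [za|za] := eqVneq (z ^+ 2 * al ^+ 2) 1.
  left; exists z^-1; first exact: specV.
  by left; rewrite exprVn -[LHS]mulr1 -za mulKf.
have [zb|zb] := eqVneq (z ^+ 2 * be ^+ 2) 1.
  left; exists z^-1; first exact: specV.
  by right; rewrite exprVn -[LHS]mulr1 -zb mulKf.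
right=> k; rewrite leq_eqVlt => /orP[/eqP->|]; last exact: IH.
by rewrite exprS -mulrA; apply: step; [|apply/eqP|apply/eqP].
Qed.

Lemma gap_of_Sym3 : Sym 3 V -> `|G - 1| < `|al - be|.
Proof.
move=> /Sym3P[J1 [J2 [J3 [s1 s2 s3 VJ]]]]; apply: gap_lt.
have spec1 l : eigenvalue (J1 *m V) l -> `|l| = 1.
  by move=> /eigenvalueP[x xU x0]; apply: (eigen_norm al1 be1 s1 xU x0).
have [||||l sl sw] := @spectrum_orbit (eigenvalue (J1 *m V)).
- by apply: eigenvalue_closed; rewrite addn_gt0 r_gt0.
- by move=> l /spec1/unit_neq0.
- by move=> l; apply: (eigen_inv al1 be1 s1 s2 s3 VJ).
- by move=> l; apply: (eigen_partner al1 be1 s1).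
have spec_le z : eigenvalue (J1 *m V) z -> `|z ^+ 2 / w - 1| <= `|al - be|.
  move=> sz; have [p p01 pR] := eigen_chord al1 be1 s1 sz.
  by rewrite divr_sub1 //; apply: chord_le p01 pR => //; apply: spec1.
have [|k kr le_k] := @gap_le_orbit (l ^+ 2 / w).
  by rewrite normf_div normrX w1 spec1 // divr1 expr1n.
apply: le_trans le_k _.
have -> : l ^+ 2 / w * w ^+ (2 * k) = ((- w) ^+ k * l) ^+ 2 / w.
  by rewrite [(_ * l) ^+ 2]exprMn exprAC sqrrN -exprM mulrAC [l ^+ 2 * _]mulrC.
exact/spec_le/sw.
Qed.

(* [inl k] stands for the eigenvalue l_k of the k-th block, [inr k] for
   m_k = -w / l_k, which is conjugate to l_(k+1). *)
Definition pairing (path : bool) (x : 'I_r + 'I_r) : 'I_r + 'I_r :=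
  match x with
  | inl k => if path && (k == 0%N :> nat) then inl k else inr (ord_pred k)
  | inr k => if path && (k.+1 == r) then inr k else inl (ordS k)
  end.

Lemma ordS_eq0 (k : 'I_r) : (ordS k == 0%N :> nat) = (k.+1 == r).
Proof.
rewrite /=; have := ltn_ord k; rewrite leq_eqVlt => /orP[/eqP->|kr].
  by rewrite modnn !eqxx.
by rewrite modn_small // (ltn_eqF kr).
Qed.

Lemma pairingK path : involutive (pairing path).
Proof.
case=> k /=; case: ifP => kP /=; first by rewrite kP.
- have := ordS_eq0 (ord_pred k); rewrite ord_predK /= => <-.
  by rewrite kP.
- by rewrite kP.
- by have := ordS_eq0 k; rewrite /= => ->; rewrite kP ordSK.
Qed.

Lemma Sym3_of_gap : `|G - 1| < `|al - be| -> Sym 3 V.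
Proof.
(* The conjugate pairs form either a path with real ends l_0 = 1 and m_(r-1) = -1, or a cycle
   through l_0 = i. The equation for [l0] makes [root_le_gap] apply to l_k^2 / w. *)
move=> ltG; have [path [l0 [l01 l0r l0P]]] : exists path (l0 : R[i]),
    [/\ `|l0| = 1, l0 ^+ (2 * r) * w ^+ r = (-1) ^+ r.-1 &
      if path then l0 = 1 /\ (- w) ^+ r = -1 else (- w) ^+ r = 1].
  have sr : (-1) ^+ r = - (-1) ^+ r.-1 :> R[i].
    by rewrite -{1}(prednK r_gt0) exprS mulN1r.
  have wE : w ^+ r = (-1) ^+ r * (- w) ^+ r by rewrite -exprMn mulN1r opprK.
  have [wr|wr] : (- w) ^+ r = -1 \/ (- w) ^+ r = 1.
    by rewrite exprNn -signr_odd; case: wr_sign => ->; case: odd;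
       rewrite ?expr0 ?expr1 ?mulN1r ?mul1r ?opprK; [left|right|right|left].
  - exists true, 1; split=> //; first exact: normr1.
    by rewrite expr1n mul1r wE wr sr mulrN1 opprK.
  - exists false, 'i%C; split=> //; first by apply: unit_sqn; rewrite /sqn /=; ring.
    (* For even r, (-w)^r = w^r = -1, so the cycle arises only for odd r. *)
    have ro : odd r.
      apply/negPn/negP => re; move: wr; rewrite exprNn wr_even //.
      rewrite -signr_odd (negPf re) mul1r => /eqP.
      by rewrite eq_sym -addr_eq0 -mulr2n pnatr_eq0.
    rewrite exprM sqr_i wE wr mulr1 -exprD addnn -mul2n exprM.
    rewrite sqrrN !expr1n -signr_odd.
    by have -> : odd r.-1 = false by lia.
pose l (k : 'I_r) := l0 * (- w^-1) ^+ k; pose m k := - w / l k.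
have l1 k : `|l k| = 1.
  by rewrite normrM l01 mul1r normrX normrN normfV w1 invr1 expr1n.
have lne k := unit_neq0 (l1 k).
have m1 k : `|m k| = 1 by rewrite normrM normrN w1 normfV l1 invr1 mulr1.
have /fin_all_exists2[p p01 pR] k : exists2 p : R[i], 0 <= p <= 1 &
    l k * (p / al + (1 - p) / be) \is Num.real.
  apply: le_chord => //; rewrite -(divr_sub1 _ w1).
  apply: (le_trans _ (ltW ltG)); apply: root_le_gap => //.
  rewrite -l0r.
  have -> : l k ^+ 2 / w = l0 ^+ 2 * (w * (w ^+ (2 * k.+1))^-1).
    rewrite /l exprMn exprAC sqrrN -exprM exprVn mulnS exprD.
    move: (w ^+ (2 * k)) (expf_neq0 (2 * k) w0) => z z0.
    by field; rewrite z0 al0 be0.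
  have wk : (w ^+ (2 * k.+1))^-1 ^+ r = 1.
    by rewrite exprVn -exprM mulnAC exprM w2r expr1n invr1.
  by rewrite [LHS]exprMn [(w * _) ^+ r]exprMn wk -exprM mulr1.
have lS (k : 'I_r) : ~~ (path && (k.+1 == r)) -> l (ordS k) = (m k)^-1.
  move=> kP; have E : l (ordS k) = l0 * (- w^-1) ^+ k.+1.
    rewrite /l /=; have := ltn_ord k; rewrite leq_eqVlt => /orP[/eqP kr|kr].
      (* The index wraps around only in the cycle, which (-w)^r = 1 closes. *)
      move: kP l0P; rewrite kr eqxx andbT; case: (path) => // _ wr.
      by rewrite modnn expr0 -invrN exprVn wr invr1.
    by rewrite modn_small.
  rewrite E /m invf_div exprSr mulrA -/(l k).
  by field; rewrite al0 be0.
pose e := row_mx (\row_k l k) (\row_k m k).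
have eE x : e 0 (unsplit x) = match x with inl k => l k | inr k => m k end.
  by rewrite mxE unsplitK; case: x => k; rewrite mxE.
apply: (@Sym3_of_spectrum _ _ _ _ l m p (unsplit \o pairing path \o @split r r)).
- exact: al1.
- exact: be1.
- exact: l1.
- by move=> k; rewrite /m mulrCA divff ?mulr1.
- exact: p01.
- exact: pR.
- by move=> k; rewrite /= unsplitK pairingK splitK.
move=> i; rewrite -/e -{2}(splitK i) /=; move: (split i) => {i} x.
have cE y : e 0 (unsplit y) = (e 0 (unsplit x))^-1 ->
    e 0 (unsplit y) = (e 0 (unsplit x))^*%R.
  move=> ->; rewrite conj_unit //; rewrite eE.
  by case: x.
apply: cE; rewrite !eE; case: x => k /=; case: ifP => kP.
- case/andP: kP => pt /eqP k0; rewrite pt in l0P; case: l0P => l0E _.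
  by rewrite /l k0 l0E expr0 mulr1 invr1.
- have := lS (ord_pred k); rewrite -ordS_eq0 ord_predK kP => -> //.
  by rewrite invrK.
- case/andP: kP => pt /eqP kr; rewrite pt in l0P; case: l0P => l0E wr.
  have -> : m k = (- w) ^+ r.
    by rewrite /m /l l0E mul1r -[in RHS]kr -invrN exprVn invrK exprS.
  by rewrite wr invrN1.
- by apply: lS; rewrite kP.
Qed.

End EqualMultiplicities.

(** * The four conditions against the gap inequality *)

Theorem theorem3p23 (R : realType) (d r s : nat) (alpha beta : R[i])
  (hd4 : (4 <= d)%N) (hdeven : ~~ odd d) (hd : d = (r + s)%N) (hrs : r = s)
  (halpha : `|alpha| = 1) (hbeta : `|beta| = 1) (hneq : alpha <> beta)
  (hP : condition_P r s alpha beta) :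
  Sym 3 (block_mx (alpha%:M : 'M_r) 0 0 (beta%:M : 'M_s)) <->
  [\/ [/\ (4 %| d)%N, (alpha * beta) ^+ r = -1 &
          forall j : nat, (1 <= j <= r)%N ->
            `|(alpha * beta) ^+ (2 * j - 1) - 1| < `|alpha - beta|],
      ~~ (4 %| d)%N /\
        (forall j : nat, (1 <= j <= r)%N ->
           `|(alpha * beta) ^+ (2 * j - 1) - 1| < `|alpha - beta|),
      [/\ ~~ (4 %| d)%N, (alpha * beta) ^+ r = -1 &
          `|expi ((r%:R - 1) / r%:R * pi) - 1| < `|alpha - beta|] |
      [/\ ~~ (4 %| d)%N, (alpha * beta) ^+ r = -1 &
          forall j : nat, (1 <= j <= r - 1)%N ->
            `|1 - alpha ^+ (2 * j + 1) * beta ^+ (2 * j - 1)|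
              < `|alpha - beta|]].
Proof.
subst s d; have r_gt1 : (1 < r)%N by lia.
have r_gt0 : (0 < r)%N by lia.
have al0 := unit_neq0 halpha; have be0 := unit_neq0 hbeta.
have w1 : `|alpha * beta| = 1 by rewrite normrM halpha hbeta mulr1.
rewrite -/(gap R r).
have gap_of_odd_powers : (forall j : nat, (1 <= j <= r)%N ->
    `|(alpha * beta) ^+ (2 * j - 1) - 1| < `|alpha - beta|) ->
    `|gap R r - 1| < `|alpha - beta|.
  (* The orbit of w under w^2 consists of odd powers w^(2j-1), with j = k + 1. *)
  move=> H; have [k kr le_k] := gap_le_orbit r_gt1 hP w1.
  apply: le_lt_trans le_k _.
  by rewrite -exprS -[(2 * k).+1](_ : (2 * k.+1 - 1)%N = _) ?H //; lia.
split=> [/(gap_of_Sym3 r_gt1 halpha hbeta hneq hP) ltG|H]; last first.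
  apply: (Sym3_of_gap r_gt1 halpha hbeta hP).
  case: H => [[_ _ /gap_of_odd_powers]|[_ /gap_of_odd_powers]|[_ _]|[_ _ H]] //.
  apply: (gap_lt r_gt1 halpha hbeta hneq hP).
  (* This orbit consists of alpha^(2j+1) beta^(2j-1), with j = k + 1. Condition (d) covers j < r; at
     j = r the point is alpha/beta, at distance exactly |alpha - beta| from 1, so strictness has to
     come from [gap_lt]. *)
  have [|k kr le_k] := @gap_le_orbit R r alpha beta r_gt1 hP
    (alpha ^+ 2 * (alpha * beta)).
    by rewrite normrM w1 normrX halpha expr1n mulr1.
  apply: le_trans le_k _.
  have E : alpha ^+ 2 * (alpha * beta) * (alpha * beta) ^+ (2 * k) =
      alpha ^+ (2 * k.+1 + 1) * beta ^+ (2 * k.+1 - 1).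
    have -> : (2 * k.+1 - 1 = (2 * k).+1)%N by lia.
    have -> : (2 * k.+1 + 1 = (2 * k).+1 + 2)%N by lia.
    by rewrite -mulrA -exprS exprMn exprD mulrCA mulrA.
  have [kr1|kr1] := ltnP k.+1 r.
    by rewrite distrC E; apply/ltW/H; lia.
  have {kr kr1} kE : r = k.+1 by lia.
  have -> : alpha ^+ 2 * (alpha * beta) * (alpha * beta) ^+ (2 * k) = alpha / beta.
    have w2 := w2r hP; rewrite kE mulnS exprD in w2.
    apply: (mulIf (mulf_neq0 al0 be0)).
    transitivity (alpha ^+ 2 * ((alpha * beta) ^+ 2 * (alpha * beta) ^+ (2 * k))).
      by move: ((alpha * beta) ^+ (2 * k)) => z; ring.
    by rewrite w2; field.
  by rewrite divr_sub1.
(* Under this value of w^r, every odd power of w has r-th power (-1)^(r-1), as [root_le_gap]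
   requires. *)
have root_lt j : (alpha * beta) ^+ r = (-1) ^+ r.-1 -> (1 <= j <= r)%N ->
    `|(alpha * beta) ^+ (2 * j - 1) - 1| < `|alpha - beta|.
  move=> wr jr; apply: le_lt_trans ltG; apply: root_le_gap => //.
  rewrite exprAC wr; have -> : (2 * j - 1 = (2 * j.-1).+1)%N by lia.
  by rewrite exprS exprM sqrr_sign expr1n mulr1.
have d4 : (4 %| r + r)%N = ~~ odd r by lia.
(* Even r gives w^r = -1 = (-1)^(r-1), hence (a). For odd r, w^r = 1 = (-1)^(r-1) gives (b), and w^r
   = -1 gives (c), the gap inequality itself. *)
rewrite d4; have [ro|re] := boolP (odd r); last first.
  have wr := wr_even r_gt1 halpha hbeta hP re.
  apply: Or41; split=> // j jr; apply: root_lt => //.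
  by rewrite wr -signr_odd; have -> : odd r.-1 by lia.
case: (wr_sign hP) => wr; last by apply: Or43.
apply: Or42; split=> // j jr; apply: root_lt => //.
by rewrite wr -signr_odd; have -> : odd r.-1 = false by lia.
Qed.
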